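(* Let $M$ be a smooth manifold, let $k\ge1$ be an integer, let $\mathcal{B}(M)$ be a basis for the topology of $M$ consisting of open subsets diffeomorphic to an open ball, and let $\mathcal{B}^{(1)}(F_k(M))$ be the associated poset of open subsets of $F_k(M)$. Then the category $VGVB(\mathcal{B}^{(1)}(F_k(M)))$ of very good vector bundles over $F_k(M)$ is equivalent to the category $\mathcal{F}(\mathcal{B}^{(1)}(F_k(M));f\mathrm{Vect}_{\mathbb{K}})$ of very good contravariant functors from $\mathcal{B}^{(1)}(F_k(M))$ to $f\mathrm{Vect}_{\mathbb{K}}$.
   Context: $F_k(M)$ is the unordered configuration space of $k$ points in $M$. $\mathcal{B}^{(1)}(F_k(M))$ is the category whose objects are the products of exactly $k$ pairwise disjoint elements $B_1,\dots,B_k$ of $\mathcal{B}(M)$, viewed as open subsets of $F_k(M)$ (configurations having exactly one point in each $B_i$), and whose morphisms are inclusions; these objects form a basis for the topology of $F_k(M)$, are diffeomorphic to open balls, and all inclusions between them are isotopy equivalences. $\mathbb{K}$ is a (topological) field and $f\mathrm{Vect}_{\mathbb{K}}$ is the category of finite dimensional $\mathbb{K}$-vector spaces, each given its product topology (via any choice of basis). A (co- or contravariant) functor on $\mathcal{B}^{(1)}(F_k(M))$ is very good if it sends isotopy equivalences (here: all morphisms) to isomorphisms; morphisms of functors are natural transformations. Write $N=F_k(M)$. An object of $VGVB(\mathcal{B}^{(1)}(N))$ is a triple $(E,\pi,F_\pi)$, where $E$ is a topological space, $\pi\colon E\to N$ is a continuous surjection and $F_\pi\colon\mathcal{B}^{(1)}(N)\to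 f\mathrm{Vect}_{\mathbb{K}}$ is a very good covariant functor, endowed with a family of homeomorphisms $\varphi^\pi_U\colon U\times F_\pi(U)\to\pi^{-1}(U)$, $U\in\mathcal{B}^{(1)}(N)$, such that: (VB0) for every $x\in N$, $\pi^{-1}(x)$ is a ($\mathbb{K}$-)vector space; (VB1) $(\pi\circ\varphi^\pi_U)(x,v)=x$ for all $U$ and all $(x,v)\in U\times F_\pi(U)$; (VB2) for all $U$ and $x\in U$, the map $F_\pi(U)\to\pi^{-1}(x)$, $v\mapsto\varphi^\pi_U(x,v)$, is an isomorphism of vector spaces; (VB3) for every morphism $j\colon U\hookrightarrow V$ of $\mathcal{B}^{(1)}(N)$, one has $\varphi^\pi_V\circ(j\times F_\pi(j))=\varphi^\pi_U$ as maps $U\times F_\pi(U)\to\pi^{-1}(V)$. A morphism $(X,p,F_p)\to(Y,q,F_q)$ is a pair $(f,\eta)$ where $f\colon X\to Y$ is a continuous map with $qf=p$ and $\eta\colon F_p\to F_q$ is a natural transformation such that $f\circ\varphi^p_U=\varphi^q_U\circ(\mathrm{id}\times\eta[U])$ for every $U\in\mathcal{B}^{(1)}(N)$, where $\eta[U]$ is the component of $\eta$ at $U$. *)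

(* Defs.v *)
From HB Require Import structures.
From mathcomp Require Import all_boot all_order all_algebra all_fingroup.
From mathcomp Require Import all_classical all_reals all_analysis.
Set Implicit Arguments.
Unset Strict Implicit.
Unset Printing Implicit Defensive.
Import Order.TTheory GRing.Theory Num.Theory.
Import numFieldNormedType.Exports.
Local Open Scope classical_set_scope.
Local Open Scope ring_scope.
Local Open Scope quotient_scope.

Record category := Category {
  obj :> Type;
  hom : obj -> obj -> Type;
  idm : forall x, hom x x;
  comp : forall x y z, hom y z -> hom x y -> hom x z;
  comp1m : forall x y (f : hom x y), comp (idm y) f = f;
  compm1 : forall x y (f : hom x y), comp f (idm x) = f;
  compmA : forall x y z t (h : hom z t) (g : hom y z) (f : hom x y),
    comp h (comp g f) = comp (comp h g) f
}.
Arguments idm {c} x.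
Arguments comp {c x y z} g f.

Definition is_iso (C : category) (x y : C) (f : hom x y) : Prop :=
  exists g : hom y x, comp g f = idm x /\ comp f g = idm y.

Definition opposite (C : category) : category :=
  @Category C (fun x y => hom y x) (fun x => idm x)
    (fun x y z g f => comp f g)
    (fun x y f => compm1 f) (fun x y f => comp1m f)
    (fun x y z t h g f => esym (compmA f g h)).

Record functor (C D : category) := Functor {
  fobj :> C -> D;
  fmap : forall x y : C, hom x y -> hom (fobj x) (fobj y);
  fmap1 : forall x : C, fmap (idm x) = idm (fobj x);
  fmapM : forall (x y z : C) (g : hom y z) (f : hom x y),
    fmap (comp g f) = comp (fmap g) (fmap f)
}.
Arguments fmap {C D} _ {x y} _.

Section functor_operations.
Variable C : category.

Definition functor_id : functor C C :=
  @Functor C C (fun x => x) (fun x y f => f)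
    (fun x => erefl) (fun x y z g f => erefl).

Lemma functor_comp_fmap1 (D E : category) (G : functor D E) (F : functor C D)
  (x : C) : fmap G (fmap F (idm x)) = idm (G (F x)).
Proof. by rewrite !fmap1. Qed.

Lemma functor_comp_fmapM (D E : category) (G : functor D E) (F : functor C D)
  (x y z : C) (g : hom y z) (f : hom x y) :
  fmap G (fmap F (comp g f)) = comp (fmap G (fmap F g)) (fmap G (fmap F f)).
Proof. by rewrite !fmapM. Qed.

Definition functor_comp (D E : category) (G : functor D E) (F : functor C D) :
    functor C E :=
  @Functor C E (fun x => G (F x)) (fun x y f => fmap G (fmap F f))
    (functor_comp_fmap1 G F) (functor_comp_fmapM G F).

End functor_operations.
Arguments functor_id C : clear implicits.

Record nattrans (C D : category) (F G : functor C D) := NatTrans {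
  ncomp :> forall x : C, hom (F x) (G x);
  naturality : forall (x y : C) (f : hom x y),
    comp (ncomp y) (fmap F f) = comp (fmap G f) (ncomp x)
}.

Section functor_category.
Variables C D : category.
Implicit Types F G H : functor C D.

Lemma nattrans_eq F G (a b : nattrans F G) : (forall x, a x = b x) -> a = b.
Proof.
case: a b => a a' [b b'] /= ab.
have e : a = b by exact: functional_extensionality_dep.
by case: b / e in b' ab *; congr NatTrans; exact: Prop_irrelevance.
Qed.

Lemma nattrans_id_natural F (x y : C) (f : hom x y) :
  comp (idm (F y)) (fmap F f) = comp (fmap F f) (idm (F x)).
Proof. by rewrite comp1m compm1. Qed.

Definition nattrans_id F : nattrans F F := NatTrans (@nattrans_id_natural F).

Lemma nattrans_comp_natural F G H (b : nattrans G H) (a : nattrans F G)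
    (x y : C) (f : hom x y) :
  comp (comp (b y) (a y)) (fmap F f) = comp (fmap H f) (comp (b x) (a x)).
Proof. by rewrite -compmA naturality compmA naturality compmA. Qed.

Definition nattrans_comp F G H (b : nattrans G H) (a : nattrans F G) :
  nattrans F H := NatTrans (nattrans_comp_natural b a).

Lemma nattrans_comp1m F G (a : nattrans F G) :
  nattrans_comp (nattrans_id G) a = a.
Proof. by apply: nattrans_eq => x; exact: comp1m. Qed.

Lemma nattrans_compm1 F G (a : nattrans F G) :
  nattrans_comp a (nattrans_id F) = a.
Proof. by apply: nattrans_eq => x; exact: compm1. Qed.

Lemma nattrans_compmA F G H I
    (c : nattrans H I) (b : nattrans G H) (a : nattrans F G) :
  nattrans_comp c (nattrans_comp b a) = nattrans_comp (nattrans_comp c b) a.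
Proof. by apply: nattrans_eq => x; exact: compmA. Qed.

Definition functor_category : category :=
  @Category (functor C D) (@nattrans C D) nattrans_id nattrans_comp
    nattrans_comp1m nattrans_compm1 nattrans_compmA.

End functor_category.

Definition full_subcategory (C : category) (P : C -> Prop) : category :=
  @Category {x : C | P x} (fun x y => hom (sval x) (sval y))
    (fun x => idm (sval x)) (fun x y z g f => comp g f)
    (fun x y f => comp1m f) (fun x y f => compm1 f)
    (fun x y z t h g f => compmA h g f).

Definition natural_iso (C D : category) (F G : functor C D) : Prop :=
  exists a : nattrans F G, forall x, is_iso (a x).

Definition equivalent_categories (C D : category) : Prop :=
  exists (F : functor C D) (G : functor D C),
    natural_iso (functor_comp G F) (functor_id C) /\
    natural_iso (functor_comp F G) (functor_id D).

HB.mixin Record isTopologicalField K & TopologicalZmodule K & GRing.Field K := {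
  mulf_continuous : continuous (fun z : K * K => z.1 * z.2);
  invf_continuous : forall x : K, x != 0 -> {for x, continuous (@GRing.inv K)}
}.

#[short(type="topologicalFieldType")]
HB.structure Definition TopologicalField :=
  {K of TopologicalZmodule K & GRing.Field K & isTopologicalField K}.

Definition fvect (K : fieldType) : category :=
  @Category (vectType K) (fun V W => 'Hom(V, W)) (fun V => \1%VF)
    (fun U V W g f => (g \o f)%VF)
    (fun U V f => comp_lfun1l f) (fun U V f => comp_lfun1r f)
    (fun U V W T h g f => comp_lfunA h g f).

(* Any other basis gives the same topology, since the linear automorphisms of
   ['rV[K]_d] are homeomorphisms. *)
Definition vect_topology (K : topologicalFieldType) (V : vectType K) :
  topologicalType := initial_topology (@passmx.rVof K V (vbasis {:V})).

Definition homeomorphism (S T : topologicalType) (f : S -> T) : Prop :=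
  continuous f /\
  exists g : T -> S, [/\ continuous g, cancel f g & cancel g f].

Section smooth_manifolds.
Variable R : realType.

(* C^r on an open set [U]. *)
Fixpoint Cr_on (r n m : nat) (U : set 'rV[R]_n)
    (f : 'rV[R]_n -> 'rV[R]_m) : Prop :=
  match r with
  | 0%N => forall x, U x -> {for x, continuous f}
  | r'.+1 => (forall x, U x -> differentiable f x) /\
             forall v : 'rV[R]_n, Cr_on r' U ('D_v f)
  end.

Definition smooth_on (n m : nat) (U : set 'rV[R]_n)
    (f : 'rV[R]_n -> 'rV[R]_m) : Prop :=
  forall r, Cr_on r U f.

(* A homeomorphism of [cdom] onto an open subset of R^n, and its inverse;
   values elsewhere are junk. *)
Record chart (n : nat) (M : topologicalType) := Chart {
  cdom : set M;
  cmap : M -> 'rV[R]_n;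
  cinv : 'rV[R]_n -> M;
  cdom_open : open cdom;
  cimg_open : open (cmap @` cdom);
  cmapK : forall x, cdom x -> cinv (cmap x) = x;
  cmap_continuous : forall x, cdom x -> {for x, continuous cmap};
  cinv_continuous : forall y, (cmap @` cdom) y -> {for y, continuous cinv}
}.

Record smoothManifold (n : nat) := SmoothManifold {
  mcarrier :> topologicalType;
  mhausdorff : hausdorff_space mcarrier;
  msecond_countable : @second_countable mcarrier;
  atlas : set (chart n mcarrier);
  atlas_cover : forall x, exists2 c, atlas c & cdom c x;
  atlas_smooth : forall c d, atlas c -> atlas d ->
    smooth_on (cmap c @` (cdom c `&` cdom d)) (cmap d \o cinv c)
}.

Definition smooth_from (n m : nat) (M : smoothManifold n) (A : set M)
    (f : M -> 'rV[R]_m) : Prop :=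
  forall c, @atlas n M c -> smooth_on (cmap c @` (A `&` cdom c)) (f \o cinv c).

Definition smooth_to (n m : nat) (M : smoothManifold n) (W : set 'rV[R]_m)
    (g : 'rV[R]_m -> M) : Prop :=
  (forall y, W y -> {for y, continuous g}) /\
  forall c, @atlas n M c ->
    smooth_on (W `&` (g @^-1` cdom c)) (cmap c \o g).

(* Not [ball 0 1], which is a cube: the norm of ['rV[R]_n] is the sup norm. *)
Definition open_unit_ball (n : nat) : set 'rV[R]_n :=
  [set v | \sum_(i < n) v ord0 i ^+ 2 < 1].

Definition diffeomorphic_to_ball (n : nat) (M : smoothManifold n)
    (B : set M) : Prop :=
  exists (f : M -> 'rV[R]_n) (g : 'rV[R]_n -> M),
    [/\ forall x, B x -> open_unit_ball (f x) /\ g (f x) = x,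
        forall y, open_unit_ball y -> B (g y) /\ f (g y) = y,
        smooth_from B f &
        smooth_to (@open_unit_ball n) g].

End smooth_manifolds.

Section configuration_spaces.
Variables (k : nat) (M : topologicalType).

Definition ordered_config : topologicalType :=
  set_type [set x : {ptws 'I_k -> M} | injective x].

Definition config_rel (x y : ordered_config) : bool :=
  [exists s : 'S_k, `[< forall i, val x i = val y (s i) >]].

Lemma config_rel_equiv : equiv_class_of config_rel.
Proof.
split.
- by move=> x; apply/existsP; exists 1%g; apply/asboolP => i; rewrite perm1.
- have h x y : config_rel x y -> config_rel y x.
    move=> /existsP[s /asboolP xy]; apply/existsP; exists s^-1%g.
    by apply/asboolP => i; rewrite xy permKV.
  by move=> x y; apply/idP/idP; exact: h.
- move=> y x z /existsP[s /asboolP xy] /existsP[t /asboolP yz].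
  apply/existsP; exists (s * t)%g; apply/asboolP => i.
  by rewrite xy yz permM.
Qed.

Canonical config_equiv := EquivRelPack config_rel_equiv.

Definition config : topologicalType :=
  quotient_topology {eq_quot config_equiv}.

Definition config_of (x : ordered_config) : config :=
  \pi_(quotient_topology {eq_quot config_equiv}) x.

Definition config_product (B : 'I_k -> set M) : set config :=
  config_of @` [set x | forall i, B i (val x i)].

Definition config_basis (BM : set (set M)) : set (set config) :=
  [set U | exists B : 'I_k -> set M,
     [/\ forall i, BM (B i), trivIset setT B & U = config_product B]].

End configuration_spaces.
Arguments config_basis k {M} BM.

Section very_good.
Variables (N : topologicalType) (BN : set (set N)).

Definition poset_category : category :=
  @Category {U : set N | BN U} (fun U V => sval U `<=` sval V)
    (fun U => @subset_refl _ (sval U))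
    (fun U V W j i => subset_trans i j)
    (fun U V i => Prop_irrelevance _ _) (fun U V i => Prop_irrelevance _ _)
    (fun U V W T l j i => Prop_irrelevance _ _).

Definition inclusion (A B : set N) (j : A `<=` B) (x : A) : B :=
  SigSub (mem_set (j _ (set_valP x))).

(* Very good functors invert isotopy equivalences. For [config_basis] every
   inclusion is one, so this asks that every morphism be inverted. *)
Definition very_good (C D : category) (F : functor C D) : Prop :=
  forall (x y : C) (j : hom x y), is_iso (fmap F j).

Definition very_good_contravariant (K : fieldType) : category :=
  full_subcategory
    (fun F : functor_category (opposite poset_category) (fvect K) =>
       very_good F).

Variable K : topologicalFieldType.

Section fibres.
Variables (E : topologicalType) (p : E -> N).

Definition fibre (x : N) : Type := {e : E | p e = x}.

Definition fibre_lmod (L : forall x, GRing.Lmodule K (fibre x)) (x : N) :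
  lmodType K := GRing.Lmodule.Pack (L x).

End fibres.

Record vgvb := VGVB {
  vtot : topologicalType;
  vproj : vtot -> N;
  vproj_continuous : continuous vproj;
  vproj_surj : forall x, exists e, vproj e = x;
  vfun : functor poset_category (fvect K);
  vfun_very_good : very_good vfun;
  vtriv : forall U : poset_category,
    set_type (sval U) * vect_topology (vfun U) ->
    set_type (vproj @^-1` sval U);
  vtriv_homeo : forall U, homeomorphism (@vtriv U);
  vfibre : forall x, GRing.Lmodule K (fibre vproj x);
  vtriv_proj : forall U x v, vproj (val (@vtriv U (x, v))) = val x;
  vtriv_linear : forall (U : poset_category) (x : set_type (sval U)),
    let h (v : vfun U) : fibre_lmod vfibre (val x) :=
      exist _ (val (@vtriv U (x, v))) (@vtriv_proj U x v) in
    linear h /\ bijective h;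
  vtriv_compat : forall (U V : poset_category) (j : hom U V) x v,
    val (@vtriv V (inclusion j x, fmap vfun j v)) = val (@vtriv U (x, v))
}.
Arguments vtriv : clear implicits.

Record vgvb_hom (X Y : vgvb) := VGVBHom {
  vmap : vtot X -> vtot Y;
  vmap_continuous : continuous vmap;
  vmap_proj : forall e, vproj (vmap e) = vproj e;
  vnat : nattrans (vfun X) (vfun Y);
  vmap_triv : forall (U : poset_category) x v,
    vmap (val (vtriv X U (x, v))) = val (vtriv Y U (x, vnat U v))
}.

End very_good.
Arguments vtriv {N BN K} X U _ : rename.
Arguments very_good_contravariant {N} BN K.

Section vgvb_category.
Variables (N : topologicalType) (BN : set (set N)) (K : topologicalFieldType).
Implicit Types X Y Z : vgvb BN K.

Lemma vgvb_hom_eq X Y (f g : vgvb_hom X Y) :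
  vmap f = vmap g -> vnat f = vnat g -> f = g.
Proof.
case: f g => f fc fp a fa [g gc gp b ga] /= fg ab; subst.
by rewrite (Prop_irrelevance fc gc) (Prop_irrelevance fp gp)
  (Prop_irrelevance fa ga).
Qed.

Lemma vgvb_id_triv X (U : poset_category BN) x v :
  val (vtriv X U (x, v)) =
  val (vtriv X U (x, nattrans_id (vfun X) U v)).
Proof. by rewrite /= id_lfunE. Qed.

Definition vgvb_id X : vgvb_hom X X :=
  @VGVBHom _ _ _ X X id (fun x => cvg_id) (fun e => erefl)
    (nattrans_id (vfun X)) (@vgvb_id_triv X).

Section composition.
Variables (X Y Z : vgvb BN K) (g : vgvb_hom Y Z) (f : vgvb_hom X Y).

Lemma vgvb_comp_continuous : continuous (vmap g \o vmap f).
Proof. by move=> x; apply: continuous_comp; exact: vmap_continuous. Qed.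

Lemma vgvb_comp_proj e : vproj ((vmap g \o vmap f) e) = vproj e.
Proof. by rewrite /= !vmap_proj. Qed.

Lemma vgvb_comp_triv (U : poset_category BN) x v :
  (vmap g \o vmap f) (val (vtriv X U (x, v))) =
  val (vtriv Z U (x, nattrans_comp (vnat g) (vnat f) U v)).
Proof. by rewrite /= !vmap_triv comp_lfunE. Qed.

Definition vgvb_comp : vgvb_hom X Z :=
  VGVBHom vgvb_comp_continuous vgvb_comp_proj vgvb_comp_triv.

End composition.

Lemma vgvb_comp1m X Y (f : vgvb_hom X Y) : vgvb_comp (vgvb_id Y) f = f.
Proof. by apply: vgvb_hom_eq => //; exact: nattrans_comp1m. Qed.

Lemma vgvb_compm1 X Y (f : vgvb_hom X Y) : vgvb_comp f (vgvb_id X) = f.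
Proof. by apply: vgvb_hom_eq => //; exact: nattrans_compm1. Qed.

Lemma vgvb_compmA X Y Z T
    (h : vgvb_hom Z T) (g : vgvb_hom Y Z) (f : vgvb_hom X Y) :
  vgvb_comp h (vgvb_comp g f) = vgvb_comp (vgvb_comp h g) f.
Proof. by apply: vgvb_hom_eq => //; exact: nattrans_compmA. Qed.

Definition vgvb_category : category :=
  @Category (vgvb BN K) (@vgvb_hom N BN K) vgvb_id vgvb_comp
    vgvb_comp1m vgvb_compm1 vgvb_compmA.

End vgvb_category.
Arguments vgvb_category {N} BN K.

(* Main.v *)
Require Import Defs.
From HB Require Import structures.
From mathcomp Require Import all_boot all_order all_algebra all_fingroup.
From mathcomp Require Import all_classical all_reals all_analysis.
Import Defs.
Set Implicit Arguments.
Unset Strict Implicit.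
Unset Printing Implicit Defensive.
Import GRing.Theory.
Local Open Scope classical_set_scope.
Local Open Scope ring_scope.

(** A very good vector bundle is a locally constant object: over a basic open
    set it is a product, and passing from one basic open set to a smaller one
    does not change the fibre. It is therefore determined by its functor of
    fibres, and the theorem holds over every space [N] with a basis [BN] of
    its topology, for the functors on [BN] that invert all inclusions.

    Inverting the (invertible) maps of a very good covariant functor gives a
    very good contravariant functor, so a bundle [X] yields the contravariant
    functor [U |-> vfun X U]. This assignment [monodromy] is an equivalence.

    - It is fully faithful. A morphism of bundles is determined by its natural
      transformation, because the charts cover the total space
      ([vgvb_hom_ext]). Conversely a natural transformation prescribes a map in
      each chart; two charts around the same point can be compared over a
      smaller basic open set, where naturality says that the prescriptions
      agree ([nattrans_vtriv]), and the glued map is continuous since linear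
      maps between finite dimensional spaces are ([lfun_continuous]).

    - It is essentially surjective. Given a very good functor [F], each [x] gets
      the fibre [F (chosen x)], for one chosen basic open set around [x]. Two
      basic open sets [U], [V] around [x] are compared by [transition x U V]:
      restrict from [U] to some [W] inside both, then extend to [V]. The
      result does not depend on [W], satisfies the cocycle identity, and is
      locally constant in [x]. The total space has the finest topology that
      makes all the charts continuous; because transitions are locally constant
      and linear, each chart is moreover open ([total_point_open]), hence a
      homeomorphism onto its image.

    What remains is that the products of [k] pairwise disjoint basic open sets
    of a manifold do form a basis of its configuration space
    ([config_basis_basis]). They are open because the preimage of such a product
    in the ordered configurations is a finite union of boxes, one for every
    permutation. They are small enough because distinct points of a Hausdorff
    space have disjoint neighbourhoods. *)

(** * Categories *)

Definition full (C D : category) (F : functor C D) : Prop :=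
  forall (x y : C) (g : hom (F x) (F y)), exists f : hom x y, fmap F f = g.

Definition faithful (C D : category) (F : functor C D) : Prop :=
  forall (x y : C) (f g : hom x y), fmap F f = fmap F g -> f = g.

Definition essentially_surjective (C D : category) (F : functor C D) : Prop :=
  forall d : D, exists (c : C) (f : hom (F c) d), is_iso f.

(* A quasi-inverse is built from a chosen object [G d] of [C] and chosen
   mutually inverse maps [e d], [e' d] between [F (G d)] and [d]; it acts on
   morphisms by conjugating with these and lifting along [F]. *)
Section quasi_inverse.
Variables (C D : category) (F : functor C D).
Hypotheses (F_full : full F) (F_faithful : faithful F).

Definition full_lift x y (g : hom (F x) (F y)) : hom x y :=
  sval (cid (F_full g)).

Lemma fmap_full_lift x y (g : hom (F x) (F y)) : fmap F (full_lift g) = g.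
Proof. exact: svalP (cid (F_full g)). Qed.

Lemma full_lift_is_iso x y (g : hom (F x) (F y)) :
  is_iso g -> is_iso (full_lift g).
Proof.
move=> [h [hg gh]]; exists (full_lift h).
by split; apply: F_faithful; rewrite fmapM !fmap_full_lift fmap1.
Qed.

Variable G : D -> C.
Variables (e : forall d, hom (F (G d)) d) (e' : forall d, hom d (F (G d))).
Hypotheses (e'K : forall d, comp (e' d) (e d) = idm (F (G d)))
  (eK : forall d, comp (e d) (e' d) = idm d).

Definition quasi_inverse_fmap c d (g : hom c d) : hom (G c) (G d) :=
  full_lift (comp (e' d) (comp g (e c))).

Lemma quasi_inverse_fmap1 d : quasi_inverse_fmap (idm d) = idm (G d).
Proof. by apply: F_faithful; rewrite fmap_full_lift comp1m e'K fmap1. Qed.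

Lemma quasi_inverse_fmapM b c d (g : hom c d) (f : hom b c) :
  quasi_inverse_fmap (comp g f) =
  comp (quasi_inverse_fmap g) (quasi_inverse_fmap f).
Proof.
apply: F_faithful; rewrite fmapM !fmap_full_lift -!compmA; congr comp.
by rewrite [comp (e c) _]compmA eK comp1m.
Qed.

Definition quasi_inverse : functor D C :=
  @Functor D C G quasi_inverse_fmap quasi_inverse_fmap1 quasi_inverse_fmapM.

Lemma quasi_inverse_counit_natural c d (g : hom c d) :
  comp (e d) (fmap (functor_comp F quasi_inverse) g) =
  comp (fmap (functor_id D) g) (e c).
Proof. by rewrite /= fmap_full_lift compmA eK comp1m. Qed.

Lemma quasi_inverse_unit_natural c d (f : hom c d) :
  comp (full_lift (e (F d))) (fmap (functor_comp quasi_inverse F) f) =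
  comp (fmap (functor_id C) f) (full_lift (e (F c))).
Proof.
apply: F_faithful; rewrite !fmapM /= !fmap_full_lift.
by rewrite compmA eK comp1m.
Qed.

Lemma quasi_inverse_equivalence : equivalent_categories C D.
Proof.
exists F, quasi_inverse; split.
  exists (@NatTrans _ _ (functor_comp quasi_inverse F) (functor_id C)
    (fun c => full_lift (e (F c))) quasi_inverse_unit_natural) => x /=.
  by apply: full_lift_is_iso; exists (e' (F x)).
exists (@NatTrans _ _ (functor_comp F quasi_inverse) (functor_id D)
  e quasi_inverse_counit_natural) => x /=.
by exists (e' x).
Qed.

End quasi_inverse.

(** Choosing a preimage and an isomorphism for every object of the target is
what turns the pointwise hypothesis into a quasi-inverse functor. *)
Lemma equivalent_categories_ff_eso (C D : category) (F : functor C D) :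
  full F -> faithful F -> essentially_surjective F ->
  equivalent_categories C D.
Proof.
move=> F_full F_faithful F_eso.
pose G d := sval (cid (F_eso d)).
have e_ex d : exists f : hom (F (G d)) d, is_iso f.
  exact: svalP (cid (F_eso d)).
pose e d := sval (cid (e_ex d)).
have e_iso d : is_iso (e d) by exact: svalP (cid (e_ex d)).
pose e' d := sval (cid (e_iso d)).
have e'P d : comp (e' d) (e d) = idm (F (G d)) /\ comp (e d) (e' d) = idm d.
  exact: svalP (cid (e_iso d)).
by apply: (@quasi_inverse_equivalence _ _ F F_full F_faithful G e e') => d;
  have [] := e'P d.
Qed.

Section iso_inverse.
Variables (C D : category).

Definition iso_inv (x y : C) (f : hom x y) (fi : is_iso f) : hom y x :=
  sval (cid fi).

Lemma iso_invK (x y : C) (f : hom x y) (fi : is_iso f) :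
  comp (iso_inv fi) f = idm x.
Proof. by have [] := svalP (cid fi). Qed.

Lemma iso_invKV (x y : C) (f : hom x y) (fi : is_iso f) :
  comp f (iso_inv fi) = idm y.
Proof. by have [] := svalP (cid fi). Qed.

Lemma iso_inv_unique (x y : C) (f : hom x y) (fi : is_iso f) (g : hom y x) :
  comp f g = idm y -> iso_inv fi = g.
Proof. by move=> fg; rewrite -[LHS]compm1 -fg compmA iso_invK comp1m. Qed.

End iso_inverse.

Section inverse_functor.
Variables (C D : category) (F : functor C D).
Hypothesis F_vg : very_good F.

Definition inverse_fmap (x y : opposite C) (f : hom x y) : hom (F x) (F y) :=
  iso_inv (F_vg (f : @hom C y x)).

Lemma inverse_fmap1 (x : opposite C) : inverse_fmap (idm x) = idm (F x).
Proof. by apply: iso_inv_unique; rewrite compm1 fmap1. Qed.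

Lemma inverse_fmapM (x y z : opposite C) (g : hom y z) (f : hom x y) :
  inverse_fmap (comp g f) = comp (inverse_fmap g) (inverse_fmap f).
Proof.
apply: iso_inv_unique.
rewrite [fmap F _](@fmapM _ _ F z y x f g) -compmA [comp (fmap F g) _]compmA.
by rewrite iso_invKV comp1m iso_invKV.
Qed.

Definition inverse_functor : functor (opposite C) D :=
  @Functor (opposite C) D F inverse_fmap inverse_fmap1 inverse_fmapM.

Lemma inverse_functor_very_good : very_good inverse_functor.
Proof.
move=> x y f; exists (fmap F (f : @hom C y x)); split.
  exact: iso_invKV.
exact: iso_invK.
Qed.

End inverse_functor.

Section inverse_nattrans.
Variables (C D : category) (F G : functor C D).
Hypotheses (F_vg : very_good F) (G_vg : very_good G).

Lemma inverse_nattrans_natural (a : nattrans F G) (x y : opposite C)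
  (f : hom x y) :
  comp (a y) (fmap (inverse_functor F_vg) f) =
  comp (fmap (inverse_functor G_vg) f) (a x).
Proof.
rewrite -[LHS]comp1m -(iso_invK (G_vg (f : @hom C y x))) -!compmA; congr comp.
by rewrite compmA -naturality -compmA iso_invKV compm1.
Qed.

Definition inverse_nattrans (a : nattrans F G) :
    nattrans (inverse_functor F_vg) (inverse_functor G_vg) :=
  @NatTrans _ _ (inverse_functor F_vg) (inverse_functor G_vg) a
    (inverse_nattrans_natural a).

Lemma inverse_nattransK_natural
  (b : nattrans (inverse_functor F_vg) (inverse_functor G_vg))
  (x y : C) (f : hom x y) :
  comp (b y) (fmap F f) = comp (fmap G f) (b x).
Proof.
have /= bn := @naturality _ _ _ _ b y x f.
rewrite -[LHS]comp1m -(iso_invKV (G_vg f)) -!compmA; congr comp.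
by rewrite compmA -[comp (iso_inv _) _]bn -compmA iso_invK compm1.
Qed.

Definition inverse_nattransK
    (b : nattrans (inverse_functor F_vg) (inverse_functor G_vg)) :
  nattrans F G := @NatTrans _ _ F G b (inverse_nattransK_natural b).

End inverse_nattrans.

Section unopposite.
Variables (C D : category).

Definition unopposite (F : functor (opposite (opposite C)) D) : functor C D :=
  @Functor C D F (fun x y (f : hom x y) => @fmap _ _ F x y f)
    (fmap1 F) (fun x y z g f => @fmapM _ _ F x y z g f).

(** Inverting a contravariant functor gives a functor on the double opposite,
whose objects and morphisms are those of [C] up to conversion but which is not
the category [C] itself. *)
Definition contra_inverse (G : functor (opposite C) D) (G_vg : very_good G) :
  functor C D := unopposite (inverse_functor G_vg).

Lemma contra_inverse_very_good (G : functor (opposite C) D)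
  (G_vg : very_good G) : very_good (contra_inverse G_vg).
Proof.
move=> x y j; exact: (@inverse_functor_very_good _ _ _ G_vg x y j).
Qed.

Lemma inverse_contra_inverse_fmap (G : functor (opposite C) D)
  (G_vg : very_good G) (x y : opposite C) (f : hom x y) :
  fmap (inverse_functor (contra_inverse_very_good G_vg)) f = fmap G f.
Proof. by apply: iso_inv_unique; exact: iso_invK. Qed.

End unopposite.

(** * Topology of finite dimensional vector spaces *)

Section sum_mul_continuous.
Variables (T : topologicalType) (K : topologicalFieldType).

Lemma add_fun_continuous (f g : T -> K) :
  continuous f -> continuous g -> continuous (fun t => f t + g t).
Proof.
move=> fc gc t; apply: (@continuous_comp _ _ _ (fun t => (f t, g t))
  (fun z : K * K => z.1 + z.2)); last exact: add_continuous.
by apply: cvg_pair; [exact: fc|exact: gc].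
Qed.

Lemma mul_fun_continuous (f g : T -> K) :
  continuous f -> continuous g -> continuous (fun t => f t * g t).
Proof.
move=> fc gc t; apply: (@continuous_comp _ _ _ (fun t => (f t, g t))
  (fun z : K * K => z.1 * z.2)); last exact: mulf_continuous.
by apply: cvg_pair; [exact: fc|exact: gc].
Qed.

Lemma sum_fun_continuous (I : Type) (r : seq I) (f : I -> T -> K) :
  (forall i, continuous (f i)) ->
  continuous (fun t => \sum_(i <- r) f i t).
Proof.
move=> fc; elim: r => [|i r IHr].
  by under eq_fun do rewrite big_nil; exact: cst_continuous.
by under eq_fun do rewrite big_cons; exact: add_fun_continuous.
Qed.

End sum_mul_continuous.

Lemma mx_entry_continuous (T : topologicalType) (m n : nat) (i : 'I_m)
  (j : 'I_n) : continuous (fun A : 'M[T]_(m, n) => A i j).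
Proof.
move=> A C AC; exists (fun i' j' => if (i' == i) && (j' == j) then C else setT).
  by move=> i' j'; case: ifP => [/andP[/eqP-> /eqP->]//|_]; exact: filterT.
by move=> B /(_ i j); rewrite !eqxx.
Qed.

(** A neighbourhood of a matrix constrains every entry, and there are finitely
many of them. *)
Lemma mx_continuous (S T : topologicalType) (m n : nat)
    (f : S -> 'M[T]_(m, n)) :
  (forall i j, continuous (fun s => f s i j)) -> continuous f.
Proof.
move=> fc s B [P sP PB].
suff : \forall t \near s, forall i j, P i j (f t i j).
  by apply: filterS => t; exact: PB.
by apply: filter_forall => i; apply: filter_forall => j; exact: fc.
Qed.

Lemma mulmxr_continuous (K : topologicalFieldType) (m n p : nat)
  (A : 'M[K]_(n, p)) : continuous (fun u : 'M[K]_(m, n) => u *m A).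
Proof.
apply: mx_continuous => i j; under eq_fun do rewrite mxE.
apply: sum_fun_continuous => k; apply: mul_fun_continuous.
  exact: mx_entry_continuous.
exact: cst_continuous.
Qed.

(** In coordinates a linear map is the multiplication by a matrix, whose entries
are sums of products with constants. *)
Lemma lfun_continuous (K : topologicalFieldType) (V W : vectType K)
  (f : 'Hom(V, W)) :
  continuous (f : vect_topology V -> vect_topology W).
Proof.
apply: continuous_comp_initial => v.
rewrite [_ \o _](_ : _ = (fun u => u *m passmx.mxof (vbasis {:V})
  (vbasis {:W}) f) \o (passmx.rVof (vbasis {:V}))).
  apply: (@continuous_comp (vect_topology V) 'rV[K]_(\dim {:V})).
    exact: initial_continuous.
  exact: mulmxr_continuous.
by apply/funext => u /=; rewrite (passmx.rVof_app _ (vbasisP {:V})).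
Qed.

(** * Morphisms of very good vector bundles *)

Section basis.
Variables (N : topologicalType) (BN : set (set N)).
Hypothesis BN_basis : basis BN.
Implicit Types U V W : poset_category BN.

Lemma basis_ex_in (A : set N) (x : N) : nbhs x A ->
  exists2 U : poset_category BN, sval U x & sval U `<=` A.
Proof.
by move=> /(BN_basis.2 x)[U [BU Ux] UA]; exists (exist _ U BU).
Qed.

Lemma basis_ex (x : N) : exists U, sval U x.
Proof.
by have [|U Ux _] := @basis_ex_in setT x; [exact: filterT|exists U].
Qed.

Lemma basis_nbhs U (x : N) : sval U x -> nbhs x (sval U).
Proof.
by move=> Ux; apply: open_nbhs_nbhs; split => //; apply/BN_basis.1/svalP.
Qed.

Lemma basis_exI U V (x : N) : sval U x -> sval V x ->
  exists W, [/\ sval W x, sval W `<=` sval U & sval W `<=` sval V].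
Proof.
move=> /basis_nbhs Ux /basis_nbhs Vx.
have [W Wx] := basis_ex_in (filterI Ux Vx).
by rewrite subsetI => -[]; exists W.
Qed.

End basis.

Lemma comp_continuous (S T T' : topologicalType) (f : S -> T) (g : T -> T') :
  continuous f -> continuous g -> continuous (g \o f).
Proof. by move=> fc gc s A /gc; exact: fc. Qed.

Lemma id_prod_continuous (S T T' : topologicalType) (g : T -> T') :
  continuous g -> continuous (fun z : S * T => (z.1, g z.2)).
Proof.
move=> gc [s t] A [[B C] /= [sB tC] BCA]; exists (B, g @^-1` C).
  by split => //; exact: gc.
by move=> z [Bz Cz]; apply: BCA.
Qed.

Definition set_elt (T : Type) (A : set T) (x : T) (Ax : A x) : set_type A :=
  SigSub (mem_set Ax).

Section vgvb_theory.
Variables (N : topologicalType) (BN : set (set N)) (K : topologicalFieldType).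
Implicit Types (X Y : vgvb BN K) (U V W : poset_category BN).

Local Notation over X U := (@vproj _ _ _ X @^-1` sval U).

Lemma very_good_surj (F : functor (poset_category BN) (fvect K)) U V
    (j : hom U V) (v : F V) :
  very_good F -> exists w : F U, fmap F j w = v.
Proof.
move=> /(_ _ _ j)[g [_ jg]]; exists (g v).
by rewrite -[RHS](id_lfunE v) -[\1%VF]jg [RHS]comp_lfunE.
Qed.

Lemma vtriv_inj X U x : injective (fun v => val (vtriv X U (x, v))).
Proof.
have [_ [g [_ gK _]]] := vtriv_homeo X U.
by move=> v w /val_inj /(can_inj gK)[].
Qed.

Lemma vtriv_surj X U (e : vtot X) : sval U (vproj e) ->
  exists x v, val (vtriv X U (x, v)) = e.
Proof.
move=> Ue; have [_ [g [_ _ gK]]] := vtriv_homeo X U.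
pose e' := @set_elt _ (over X U) e Ue.
by exists (g e').1, (g e').2; rewrite -surjective_pairing gK.
Qed.

(** The point reached from [v] in the chart over [V] is reached in the chart
over [U] from a preimage of [v], which exists as [fmap (vfun X) j] is onto. *)
Lemma vtriv_restrict X U V (j : hom U V) (y : set_type (sval V))
    (v : vfun X V) (Uy : sval U (val y)) :
  exists v0 : vfun X U, v = fmap (vfun X) j v0 /\
    val (vtriv X V (y, v)) = val (vtriv X U (set_elt Uy, v0)).
Proof.
have [v0 <-] := very_good_surj j v (@vfun_very_good _ _ _ X).
exists v0; split => //; rewrite -(vtriv_compat j).
by congr (val (vtriv _ _ (_, _))); exact: val_inj.
Qed.

Hypothesis BN_basis : basis BN.

(** Both sides can be computed over a basic open set contained in [U] and [V],
where they agree by naturality of [a]. *)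
Lemma nattrans_vtriv X Y (a : nattrans (vfun X) (vfun Y)) U V x v y w :
  val (vtriv X U (x, v)) = val (vtriv X V (y, w)) ->
  val (vtriv Y U (x, a U v)) = val (vtriv Y V (y, a V w)).
Proof.
move=> vw; have xy : val x = val y.
  by have := congr1 (@vproj _ _ _ X) vw; rewrite !vtriv_proj.
have Vx : sval V (val x) by rewrite xy; exact: set_valP.
have [W [Wx jU jV]] := basis_exI BN_basis (set_valP x) Vx.
have Wy : sval W (val y) by rewrite -xy.
have [v0 [vv0 vE]] := @vtriv_restrict X W U jU x v Wx.
have [w0 [ww0 wE]] := @vtriv_restrict X W V jV y w Wy.
have xyW : set_elt Wx = set_elt Wy :> set_type (sval W).
  exact: val_inj.
have /vtriv_inj v0w0 : val (vtriv X W (set_elt Wx, v0)) =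
    val (vtriv X W (set_elt Wx, w0)).
  by rewrite -vE vw wE xyW.
have aE Z (j : hom W Z) z u : z = inclusion j (set_elt Wx) ->
    val (vtriv Y Z (z, a Z (fmap (vfun X) j u))) =
    val (vtriv Y W (set_elt Wx, a W u)).
  move=> ->; rewrite -(vtriv_compat j); congr (val (vtriv _ _ (_, _))).
  by have /lfunP/(_ u) := naturality a j; rewrite /= !comp_lfunE.
by rewrite vv0 ww0 (aE U) ?(aE V) ?v0w0//; exact: val_inj.
Qed.

Section vgvb_hom_of.
Variables (X Y : vgvb BN K) (a : nattrans (vfun X) (vfun Y)).

Lemma vmap_of_ex (e : vtot X) : exists f : vtot Y, forall U x v,
  val (vtriv X U (x, v)) = e -> f = val (vtriv Y U (x, a U v)).
Proof.
have [U Ue] := basis_ex BN_basis (vproj e).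
have [x [v <-]] := vtriv_surj Ue; exists (val (vtriv Y U (x, a U v))).
by move=> V y w /nattrans_vtriv ->.
Qed.

Definition vmap_of (e : vtot X) : vtot Y := sval (cid (vmap_of_ex e)).

Lemma vmap_of_triv U x v :
  vmap_of (val (vtriv X U (x, v))) = val (vtriv Y U (x, a U v)).
Proof. exact: (svalP (cid (vmap_of_ex (val (vtriv X U (x, v)))))). Qed.

Lemma vmap_of_proj e : vproj (vmap_of e) = vproj e.
Proof.
have [U Ue] := basis_ex BN_basis (vproj e).
by have [x [v <-]] := vtriv_surj Ue; rewrite vmap_of_triv !vtriv_proj.
Qed.

(** Continuity is local, and over a basic open set the map is the product of
an identity and a linear map. *)
Lemma vmap_of_continuous : continuous vmap_of.
Proof.
move=> e A; have [U Ue] := basis_ex BN_basis (vproj e).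
have [_ [g [gc _ gK]]] := vtriv_homeo X U.
pose e' := @set_elt _ (over X U) e Ue.
pose f (z : set_type (sval U) * vect_topology (vfun X U)) :=
  val (vtriv Y U (z.1, (a U z.2 : vect_topology (vfun Y U)))).
have fE t : vmap_of (val t) = f (g t).
  by rewrite -[in LHS](gK t) [g t]surjective_pairing vmap_of_triv.
have fc : continuous f.
  have c1 := id_prod_continuous (S := set_type (sval U))
    (@lfun_continuous _ _ _ (a U)).
  have c2 := @initial_continuous (set_type (over Y U)) (vtot Y) set_val.
  exact: (comp_continuous c1 (comp_continuous (vtriv_homeo Y U).1 c2)).
rewrite (fE e') => /(comp_continuous gc fc) [_ [[B oB <-] Be BA]].
have oU : open (over X U).
  apply: open_comp => [? _|]; first exact: vproj_continuous.
  exact: BN_basis.1 (svalP U).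
have : nbhs e (B `&` over X U).
  by apply: open_nbhs_nbhs; split => //; exact: openI.
apply: filterS => t [Bt Ut]; have /= := BA (@set_elt _ (over X U) t Ut) Bt.
by rewrite -fE.
Qed.

Definition vgvb_hom_of : vgvb_hom X Y :=
  VGVBHom vmap_of_continuous vmap_of_proj vmap_of_triv.

End vgvb_hom_of.

Lemma vgvb_hom_ext X Y (f g : vgvb_hom X Y) : vnat f = vnat g -> f = g.
Proof.
move=> fg; apply: vgvb_hom_eq => //; apply/funext => e.
have [U Ue] := basis_ex BN_basis (vproj e).
by have [x [v <-]] := vtriv_surj Ue; rewrite !vmap_triv fg.
Qed.

End vgvb_theory.

(** * The bundle of a very good functor *)

(* Linear structures on the fibres of a bundle live on subtypes of its total
   space; they are transported along a bijection with a vector space. *)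
Section transported_lmodule.
Variables (K : pzRingType) (V : lmodType K) (T : Type).
Variables (f : T -> V) (g : V -> T).
Hypotheses (fK : cancel f g) (gK : cancel g f).

(** The structures declared below are keyed on this alias instead of on [T], and
they depend on the bijection, hence its proofs appear as arguments. *)
Definition transported of cancel f g & cancel g f : Type := T.

Local Notation T' := (transported fK gK).

HB.instance Definition _ := gen_eqMixin T'.
HB.instance Definition _ := gen_choiceMixin T'.

Definition transported_add (s t : T') : T' := g (f s + f t).
Definition transported_opp (s : T') : T' := g (- f s).
Definition transported_scale (a : K) (s : T') : T' := g (a *: f s).

Lemma transported_addA : associative transported_add.
Proof. by move=> r s t; rewrite /transported_add !gK addrA. Qed.

Lemma transported_addC : commutative transported_add.
Proof. by move=> s t; rewrite /transported_add addrC. Qed.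

Lemma transported_add0 : left_id (g 0 : T') transported_add.
Proof. by move=> s; rewrite /transported_add gK add0r fK. Qed.

Lemma transported_addN :
  left_inverse (g 0 : T') transported_opp transported_add.
Proof. by move=> s; rewrite /transported_add gK addNr. Qed.

HB.instance Definition _ := GRing.isZmodule.Build T'
  transported_addA transported_addC transported_add0 transported_addN.

Lemma transported_scaleA a b (s : T') :
  transported_scale a (transported_scale b s) = transported_scale (a * b) s.
Proof. by rewrite /transported_scale gK scalerA. Qed.

Lemma transported_scale1 : left_id 1 transported_scale.
Proof. by move=> s; rewrite /transported_scale scale1r fK. Qed.

Lemma transported_coordD (s t : T') : f (s + t) = f s + f t.
Proof. exact: gK. Qed.

Lemma transported_scaleDr : right_distributive transported_scale +%R.
Proof.
move=> a s t; apply: (can_inj fK).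
by rewrite [RHS]transported_coordD !gK scalerDr.
Qed.

Lemma transported_scaleDl (s : T') :
  {morph transported_scale^~ s : a b / a + b}.
Proof.
move=> a b; apply: (can_inj fK).
by rewrite [RHS]transported_coordD !gK scalerDl.
Qed.

HB.instance Definition _ := GRing.Zmodule_isLmodule.Build K T'
  transported_scaleA transported_scale1 transported_scaleDr transported_scaleDl.

Definition transported_lmodule : GRing.Lmodule K T := GRing.Lmodule.class T'.

Lemma transported_linear (W : lmodType K) (h : W -> T) :
  linear (f \o h) -> linear (h : W -> GRing.Lmodule.Pack transported_lmodule).
Proof.
move=> fh a s t; apply: (can_inj fK); rewrite [LHS](fh a s t)/=.
by rewrite [RHS]transported_coordD; congr (_ + _); exact: esym (gK _).
Qed.

End transported_lmodule.

Section bundle_of_functor.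
Variables (N : topologicalType) (BN : set (set N)) (K : topologicalFieldType).
Hypothesis BN_basis : basis BN.
Variable F : functor (poset_category BN) (fvect K).
Hypothesis F_vg : very_good F.
Implicit Types U V W : poset_category BN.

Definition restrict_extend W U V (j : hom W U) (j' : hom W V) :
    hom (F U) (F V) :=
  comp (fmap F j') (iso_inv (F_vg j)).

Lemma restrict_extend_shrink W' W U V (i : hom W' W) (j : hom W U)
  (j' : hom W V) :
  restrict_extend (comp j i) (comp j' i) = restrict_extend j j'.
Proof.
rewrite /restrict_extend fmapM -compmA; congr comp.
rewrite (@iso_inv_unique _ _ _ _ _
  (comp (iso_inv (F_vg i)) (iso_inv (F_vg j)))).
  by rewrite compmA iso_invKV comp1m.
by rewrite fmapM -compmA [comp (fmap F i) _]compmA iso_invKV comp1m iso_invKV.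
Qed.

(** Both maps can be computed from a basic open set around [x] that is contained
in [W] and in [W']. *)
Lemma restrict_extend_unique (x : N) W W' U V (j : hom W U) (j' : hom W V)
    (k : hom W' U) (k' : hom W' V) : sval W x -> sval W' x ->
  restrict_extend j j' = restrict_extend k k'.
Proof.
move=> Wx W'x; have [Z [Zx i i']] := basis_exI BN_basis Wx W'x.
rewrite -(restrict_extend_shrink (i : hom Z W)).
rewrite -(restrict_extend_shrink (i' : hom Z W') k k').
congr restrict_extend.
  exact: (@Prop_irrelevance (sval Z `<=` sval U)).
exact: (@Prop_irrelevance (sval Z `<=` sval V)).
Qed.

Lemma restrict_extend_comp W U V V' (i : hom W U) (j : hom W V)
  (k : hom W V') :
  comp (restrict_extend j k) (restrict_extend i j) = restrict_extend i k.
Proof.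
rewrite /restrict_extend -compmA; congr comp.
by rewrite compmA iso_invK comp1m.
Qed.

(** The zero map is a junk value, taken when no basic open set around [x] lies
in both [U] and [V]. *)
Lemma transition_ex (x : N) U V : exists f : 'Hom(F U, F V),
  forall W (j : hom W U) (j' : hom W V), sval W x -> f = restrict_extend j j'.
Proof.
have [[W [Wx j j']]|none] := pselect (exists W : poset_category BN,
    [/\ sval W x, sval W `<=` sval U & sval W `<=` sval V]).
  exists (restrict_extend (j : hom W U) (j' : hom W V)) => W' k k'.
  exact: restrict_extend_unique.
by exists 0 => W j j' Wx; exfalso; apply: none; exists W.
Qed.

Definition transition (x : N) U V : 'Hom(F U, F V) :=
  sval (cid (transition_ex x U V)).

Lemma transitionE (x : N) W U V (j : hom W U) (j' : hom W V) : sval W x ->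
  transition x U V = restrict_extend j j'.
Proof. exact: (svalP (cid (transition_ex x U V))). Qed.

Lemma transition_fmap (x : N) U V (j : hom U V) : sval U x ->
  transition x U V = fmap F j.
Proof.
move=> Ux; rewrite (transitionE (idm U) j Ux) /restrict_extend.
by rewrite (@iso_inv_unique _ _ _ _ _ (idm (F U))) ?compm1 ?fmap1.
Qed.

(** The cocycle identity: all three transitions factor through one basic open
set around [x] contained in [U], [V] and [W]. *)
Lemma transition_comp (x : N) U V W (v : F U) :
  sval U x -> sval V x -> sval W x ->
  transition x V W (transition x U V v) = transition x U W v.
Proof.
move=> Ux Vx Wx; have [Y [Yx jU jV]] := basis_exI BN_basis Ux Vx.
have [Z [Zx jY jW]] := basis_exI BN_basis Yx Wx.
pose i : hom Z U := subset_trans jY jU; pose j : hom Z V := subset_trans jY jV.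
pose k : hom Z W := jW.
rewrite (transitionE i j Zx) (transitionE j k Zx) (transitionE i k Zx).
by rewrite -comp_lfunE; congr (fun_of_lfun _ v); exact: restrict_extend_comp.
Qed.

Lemma transition_id (x : N) U (v : F U) : sval U x -> transition x U U v = v.
Proof. by move=> Ux; rewrite (transition_fmap (idm U)) ?fmap1 ?id_lfunE. Qed.

Lemma transitionK (x : N) U V (v : F U) : sval U x -> sval V x ->
  transition x V U (transition x U V v) = v.
Proof. by move=> Ux Vx; rewrite transition_comp ?transition_id. Qed.

(** The basic open set used to compute the transition at [x] serves for all of
its own points. *)
Lemma transition_locally_constant (x : N) U V : sval U x -> sval V x ->
  \forall y \near x, transition y U V = transition x U V.
Proof.
move=> Ux Vx; have [W [Wx j j']] := basis_exI BN_basis Ux Vx.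
apply: filterS (basis_nbhs BN_basis Wx) => y Wy.
by rewrite !(transitionE (j : hom W U) (j' : hom W V)).
Qed.

Definition chosen (x : N) : poset_category BN :=
  sval (cid (basis_ex BN_basis x)).

Lemma chosenP x : sval (chosen x) x.
Proof. exact: svalP (cid (basis_ex BN_basis x)). Qed.

Definition total : Type := {x : N & vect_topology (F (chosen x))}.

HB.instance Definition _ := gen_eqMixin total.
HB.instance Definition _ := gen_choiceMixin total.

Definition total_proj (e : total) : N := projT1 e.

Definition total_point U (z : set_type (sval U) * vect_topology (F U)) :
    total :=
  existT _ (val z.1) (transition (val z.1) U (chosen (val z.1)) z.2).

(** This is the inverse of the chart over [U]; it is meaningful only for the
points [e] that lie over [U]. *)
Definition total_coord U (e : total) : vect_topology (F U) :=
  transition (total_proj e) (chosen (total_proj e)) U (projT2 e).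

Lemma total_coord_point U V z : sval U (val z.1) ->
  total_coord U (total_point (U := V) z) = transition (val z.1) V U z.2.
Proof.
by move=> Uz; rewrite /total_coord /= transition_comp//;
  [exact: set_valP|exact: chosenP].
Qed.

Lemma total_pointK U z : total_coord U (total_point (U := U) z) = z.2.
Proof.
by rewrite total_coord_point ?transition_id//; exact: set_valP.
Qed.

Lemma total_coordK U e (Ue : sval U (total_proj e)) :
  total_point (set_elt Ue, total_coord U e) = e.
Proof.
case: e Ue => x v /= Ux; rewrite /total_point /= /total_coord /=.
by rewrite transitionK//; exact: chosenP.
Qed.

Definition total_open : set_system total :=
  [set O | forall U, open (total_point (U := U) @^-1` O)].

Lemma total_openT : total_open setT.
Proof. by move=> U; rewrite preimage_setT; exact: openT. Qed.

Lemma total_openI : setI_closed total_open.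
Proof. by move=> O O' Oo O'o U; rewrite preimage_setI; exact: openI. Qed.

Lemma total_open_bigU (I : Type) (f : I -> set total) :
  (forall i, total_open (f i)) -> total_open (\bigcup_i f i).
Proof.
by move=> fo U; rewrite preimage_bigcup; apply: bigcup_open => i _; exact: fo.
Qed.

HB.instance Definition _ := isOpenTopological.Build total
  total_openT total_openI total_open_bigU.

Lemma total_openE : @open total = total_open.
Proof. by []. Qed.

Lemma total_point_continuous U : continuous (total_point (U := U)).
Proof. by apply/continuousP => O; rewrite total_openE; exact. Qed.

Lemma total_proj_continuous : continuous total_proj.
Proof.
apply/continuousP => O oO; rewrite total_openE => U.
rewrite -comp_preimage; apply: open_comp oO => z _.
apply: (@comp_continuous _ _ _ fst set_val); last exact: initial_continuous.
by move=> w; exact: cvg_fst.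
Qed.

(** In the chart over [V], the image of [A] is the preimage of [A] under the
change of charts, which near a given point is the product of an inclusion and
of one fixed linear map [L], hence is continuous there. *)
Lemma total_point_open U (A : set (set_type (sval U) * vect_topology (F U))) :
  open A -> open (total_point (U := U) @` A).
Proof.
move=> oA; rewrite total_openE => V; rewrite openE => -[y w] /= [z Az zyw].
have zy : val z.1 = val y by have := congr1 total_proj zyw.
have Uy : sval U (val y) by rewrite -zy; exact: set_valP.
have z2 : z.2 = transition (val y) V U w.
  by rewrite -total_pointK zyw total_coord_point.
have {}zE : z = (set_elt Uy, transition (val y) V U w : vect_topology (F U)).
  by rewrite [LHS]surjective_pairing z2; congr (_, _); exact: val_inj.
move: oA; rewrite openE => /(_ _ Az); rewrite /interior zE.
move=> [[B C] /= [[_ [[B' oB' <-] B'y B'B]] Cw] BCA].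
have lc := transition_locally_constant (set_valP y) Uy.
(* On [G] the change of charts is the constant [L], and [B'] is kept. *)
pose G := [set t | [/\ B' t, sval U t
  & transition t V U = transition (val y) V U]].
have Gy : nbhs (val y) G.
  have B'n : nbhs (val y) B' by apply: open_nbhs_nbhs.
  apply: filterS (filterI B'n (filterI (basis_nbhs BN_basis Uy) lc)).
  by move=> t [? []].
pose L : vect_topology (F V) -> vect_topology (F U) := transition (val y) V U.
exists (set_val @^-1` G, L @^-1` C).
  split => /=; last exact: (@lfun_continuous _ _ _ _ w _ Cw).
  exact: (@initial_continuous (set_type (sval V)) N set_val y G Gy).
move=> [t u] /= [[B't Ut tE] Cu].
exists (set_elt Ut, transition (val y) V U u).
  by apply: BCA; split => //; exact: B'B.
rewrite -tE /total_point /= transition_comp//; first exact: set_valP.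
exact: chosenP.
Qed.

Definition total_triv U (z : set_type (sval U) * vect_topology (F U)) :
    set_type (total_proj @^-1` sval U) :=
  @set_elt _ (total_proj @^-1` sval U) (total_point z) (set_valP z.1).

Lemma total_triv_homeo U : homeomorphism (@total_triv U).
Proof.
split.
  by apply: continuous_comp_initial; exact: total_point_continuous.
pose over := set_type (total_proj @^-1` sval U).
pose overP (e : over) : sval U (total_proj (val e)) := set_valP e.
pose coord (e : over) : set_type (sval U) * vect_topology (F U) :=
  (set_elt (overP e), total_coord U (val e)).
exists coord.
have triv_coord : cancel coord (@total_triv U).
  by move=> e; apply: val_inj; exact: total_coordK.
have coord_triv : cancel (@total_triv U) coord.
  move=> z; rewrite /coord /= total_pointK [RHS]surjective_pairing.
  by congr (_, _); exact: val_inj.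
split => //; apply/continuousP => A oA.
exists (total_point (U := U) @` A); first exact: total_point_open.
apply/seteqP; split => e /=.
  move=> [z Az ze].
  by rewrite (_ : e = total_triv z) ?coord_triv//; exact: val_inj.
by move=> Ae; exists (coord e) => //; exact: total_coordK.
Qed.

Definition total_fibre_coord (x : N) (e : fibre total_proj x) : F (chosen x) :=
  let: exist e ex := e in
  match ex in _ = y return F (chosen y) with erefl => projT2 e end.

Definition total_fibre_point (x : N) (v : F (chosen x)) : fibre total_proj x :=
  exist _ (existT _ x v) erefl.

Lemma total_fibre_coordK x :
  cancel (@total_fibre_coord x) (@total_fibre_point x).
Proof. by case=> -[y v] /= yx; case: x / yx. Qed.

Lemma total_fibre_pointK x :
  cancel (@total_fibre_point x) (@total_fibre_coord x).
Proof. by []. Qed.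

Definition total_fibre_lmodule (x : N) : GRing.Lmodule K (fibre total_proj x) :=
  transported_lmodule (@total_fibre_coordK x) (@total_fibre_pointK x).

Lemma total_proj_surj x : exists e, total_proj e = x.
Proof. by exists (existT _ x (0 : F (chosen x))). Qed.

Lemma total_triv_proj U x v : total_proj (val (@total_triv U (x, v))) = val x.
Proof. by []. Qed.

(** Read in the fibre [F (chosen x)], the chart is the transition from [U] to
[chosen x], which is linear with the opposite transition as inverse. *)
Lemma total_triv_linear U (x : set_type (sval U)) :
  let h (v : F U) : fibre_lmod total_fibre_lmodule (val x) :=
    exist _ (val (@total_triv U (x, v))) (@total_triv_proj U x v) in
  linear h /\ bijective h.
Proof.
have hE v : total_fibre_coord (exist _ (val (@total_triv U (x, v)))
    (@total_triv_proj U x v)) = transition (val x) U (chosen (val x)) v.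
  by rewrite (Prop_irrelevance (@total_triv_proj U x v) erefl).
split.
  apply: transported_linear => a u v.
  apply: etrans (hE _) _; rewrite linearP.
  exact/esym/(congr2 (fun s t => a *: s + t) (hE u) (hE v)).
have Ux : sval U (val x) := set_valP x.
exists (fun e => transition (val x) (chosen (val x)) U (total_fibre_coord e)).
  by move=> v; rewrite hE transitionK//; exact: chosenP.
move=> e; apply: (can_inj (@total_fibre_coordK (val x))).
by rewrite hE transitionK//; exact: chosenP.
Qed.

Lemma total_triv_compat U V (j : hom U V) x v :
  val (@total_triv V (inclusion j x, fmap F j v)) = val (@total_triv U (x, v)).
Proof.
have Ux : sval U (val x) := set_valP x.
rewrite /= /total_point /=; congr existT.
by rewrite -(transition_fmap j Ux) transition_comp//; [exact: j|exact: chosenP].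
Qed.

Definition bundle_of_functor : vgvb BN K :=
  VGVB total_proj_continuous total_proj_surj F_vg total_triv_homeo
    total_triv_linear total_triv_compat.

End bundle_of_functor.

(** * Very good bundles and very good contravariant functors *)

Section monodromy.
Variables (N : topologicalType) (BN : set (set N)) (K : topologicalFieldType).
Hypothesis BN_basis : basis BN.

Definition monodromy_obj (X : vgvb_category BN K) :
    very_good_contravariant BN K :=
  exist _ (inverse_functor (@vfun_very_good _ _ _ X))
    (inverse_functor_very_good (@vfun_very_good _ _ _ X)).

Definition monodromy_map (X Y : vgvb_category BN K) (f : hom X Y) :
    hom (monodromy_obj X) (monodromy_obj Y) :=
  inverse_nattrans (@vfun_very_good _ _ _ X) (@vfun_very_good _ _ _ Y) (vnat f).

Lemma monodromy_map1 X : monodromy_map (idm X) = idm (monodromy_obj X).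
Proof. exact: nattrans_eq. Qed.

Lemma monodromy_mapM (X Y Z : vgvb_category BN K) (g : hom Y Z) (f : hom X Y) :
  monodromy_map (comp g f) = comp (monodromy_map g) (monodromy_map f).
Proof. exact: nattrans_eq. Qed.

Definition monodromy :
    functor (vgvb_category BN K) (very_good_contravariant BN K) :=
  @Functor (vgvb_category BN K) (very_good_contravariant BN K)
    monodromy_obj monodromy_map monodromy_map1 monodromy_mapM.

Lemma monodromy_full : full monodromy.
Proof.
move=> X Y b; exists (vgvb_hom_of BN_basis (inverse_nattransK b)).
exact: nattrans_eq.
Qed.

Lemma monodromy_faithful : faithful monodromy.
Proof.
move=> X Y f g fg; apply: vgvb_hom_ext => //; apply: nattrans_eq => U.
exact: (congr1 (fun a : nattrans (sval (monodromy X)) (sval (monodromy Y)) =>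
  a U) fg).
Qed.

(** The bundle of the inverted functor is taken to a functor which has the same
objects and, double inversion being the identity, the same maps as the given
one; identities are the components of the isomorphism. *)
Lemma monodromy_essentially_surjective : essentially_surjective monodromy.
Proof.
move=> [G G_vg]; pose F_vg := contra_inverse_very_good G_vg.
exists (bundle_of_functor BN_basis F_vg).
have natural U V (j : @hom (opposite (poset_category BN)) U V) :
    comp (idm (G V)) (fmap (inverse_functor F_vg) j) =
    comp (fmap G j) (idm (G U)).
  by rewrite inverse_contra_inverse_fmap comp1m compm1.
have natural' U V (j : @hom (opposite (poset_category BN)) U V) :
    comp (idm (G V)) (fmap G j) =
    comp (fmap (inverse_functor F_vg) j) (idm (G U)).
  by rewrite inverse_contra_inverse_fmap comp1m compm1.
exists (@NatTrans _ _ (inverse_functor F_vg) G (fun U => idm (G U)) natural).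
exists (@NatTrans _ _ G (inverse_functor F_vg) (fun U => idm (G U)) natural').
by split; apply: nattrans_eq => U; exact: comp1m.
Qed.

Lemma vgvb_equivalent_very_good_contravariant :
  equivalent_categories (vgvb_category BN K) (very_good_contravariant BN K).
Proof.
exact: (equivalent_categories_ff_eso monodromy_full monodromy_faithful
  monodromy_essentially_surjective).
Qed.

End monodromy.

(** * The product basis of the configuration space *)

Section ptws_finite.
Variables (k : nat) (M : topologicalType).

Lemma ptws_box_open (O : 'I_k -> set M) : (forall i, open (O i)) ->
  open [set x : {ptws 'I_k -> M} | forall i, O i (x i)].
Proof.
move=> Oo; rewrite openE => x Ox.
apply: (@filter_forall _ _ (fun i y => O i (y i)) (nbhs x) _) => i.
apply: (@proj_continuous _ (fun=> M) i x (O i)).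
by apply: open_nbhs_nbhs; split => //; exact: Ox.
Qed.

(** Matrices carry the box topology, which for finitely many factors is the
topology of pointwise convergence. *)
Lemma row_ptws_continuous :
  continuous (fun (u : 'rV[M]_k) => (fun i => u ord0 i) : {ptws 'I_k -> M}).
Proof.
move=> u; apply/cvg_sup; first exact/fmap_filter/(nbhs_filter u).
move=> i; move: u; apply: continuous_comp_initial.
exact: mx_entry_continuous.
Qed.

Lemma ptws_nbhs_box (x : {ptws 'I_k -> M}) (A : set {ptws 'I_k -> M}) :
  nbhs x A -> exists O : 'I_k -> set M,
    (forall i, nbhs (x i) (O i)) /\ forall y, (forall i, O i (y i)) -> A y.
Proof.
have xE : (fun i => (\row_i x i : 'rV[M]_k) ord0 i) = x.
  by apply/funext => i; rewrite mxE.
rewrite -[X in nbhs X]xE => /(@row_ptws_continuous (\row_i x i))[P xP PA].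
exists (P ord0); split=> [i|y Py].
  have xi : (\row_i x i : 'rV[M]_k) ord0 i = x i by rewrite mxE.
  by rewrite -xi; exact: xP.
rewrite (_ : y = fun i => (\row_i y i : 'rV[M]_k) ord0 i).
  by apply: PA => i j; rewrite ord1 mxE.
by apply/funext => i; rewrite mxE.
Qed.

End ptws_finite.

Section config_basis.
Variables (k : nat) (M : topologicalType) (BM : set (set M)).
Hypotheses (M_hausdorff : hausdorff_space M) (BM_basis : basis BM).

(** Around distinct points, the neighbourhoods separating each pair of them
are intersected. *)
Lemma injective_disjoint_nbhs (x : 'I_k -> M) : injective x ->
  exists D : 'I_k -> set M, (forall i, nbhs (x i) (D i)) /\ trivIset setT D.
Proof.
move=> x_inj.
have sep (ij : 'I_k * 'I_k) : exists AB : set M * set M,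
    ij.1 != ij.2 -> [/\ nbhs (x ij.1) AB.1, nbhs (x ij.2) AB.2
      & AB.1 `&` AB.2 = set0].
  case: (eqVneq ij.1 ij.2) => [_|ij_neq]; first by exists (set0, set0).
  have x_neq : x ij.1 != x ij.2 by apply: contra_neq ij_neq; exact: x_inj.
  move: M_hausdorff; rewrite open_hausdorff => /(_ _ _ x_neq)[AB].
  rewrite !inE => -[Ax Bx] [oA oB AB0]; exists AB => _.
  by split; [exact: open_nbhs_nbhs|exact: open_nbhs_nbhs|exact: AB0].
have [S SP] := choice sep.
exists (fun i =>
  [set y | forall j, i != j -> (S (i, j)).1 y /\ (S (j, i)).2 y]).
split.
  move=> i; apply: filter_forall => j.
  have [->|ij] := eqVneq i j; first by apply: filterS filterT.
  have [S1 _ _] := SP (i, j) ij.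
  have [|_ S2 _] := SP (j, i); first by rewrite eq_sym.
  by apply: filterS (filterI S1 S2).
apply/trivIsetP => i j _ _ ij; rewrite -subset0 => y [/= yi yj].
have [_ _ S0] := SP (i, j) ij.
suff : ((S (i, j)).1 `&` (S (i, j)).2) y by rewrite S0.
by split; [exact: (yi j ij).1|apply: (yj i _).2; rewrite eq_sym].
Qed.

(** An ordered configuration represents a point of the product if and only if
some permutation puts its points into the respective sets. *)
Lemma config_product_open (B : 'I_k -> set M) :
  (forall i, open (B i)) -> open (config_product B).
Proof.
move=> Bo.
rewrite (_ : open _ = open ((@config_of k M) @^-1` config_product B))//.
rewrite (_ : _ @^-1` _ = \bigcup_(s : 'S_k)
    (set_val @^-1` [set x : {ptws 'I_k -> M} | forall i, B (s i) (x i)])).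
  apply: bigcup_open => s _.
  exists [set x : {ptws 'I_k -> M} | forall i, B (s i) (x i)] => //.
  exact: (ptws_box_open (fun i => Bo (s i))).
apply/seteqP; split => x.
  move=> [y By] /eqmodP /existsP[s /asboolP yx].
  exists s^-1%g => // i /=.
  by have := By (s^-1%g i); rewrite yx permKV.
move=> [s _ xB].
have inj : injective (val x \o s^-1%g).
  by apply: inj_comp; [exact: set_valP|exact: perm_inj].
exists (set_elt (inj : [set x : {ptws 'I_k -> M} | injective x] _)).
  by move=> i /=; have := xB (s^-1%g i); rewrite permKV.
by apply/eqmodP/existsP; exists s^-1%g; apply/asboolP => i.
Qed.

(** Smallness: the points of an ordered representative [x] have neighbourhoods
[P] whose box maps into the given open set, and pairwise disjoint neighbourhoods
[D]; a basic [B i] is chosen inside both. *)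
Lemma config_basis_basis : basis (config_basis k BM).
Proof.
split.
  move=> _ [B [BB _ ->]]; apply: config_product_open => i.
  exact: BM_basis.1 (BB i).
move=> c A; rewrite nbhsE => -[C [oC Cc] CA].
have [x xc] : exists x : ordered_config k M, config_of x = c.
  by exists (generic_quotient.repr c); exact: reprK.
have : nbhs x (@config_of k M @^-1` C).
  by apply: open_nbhs_nbhs; split => //=; rewrite xc.
move=> [_ [[C' oC' <-] C'x C'C]].
have /ptws_nbhs_box[P [Px PQ]] : nbhs (val x) C' by apply: open_nbhs_nbhs.
have [D [Dx D_disj]] := injective_disjoint_nbhs (set_valP x).
have BP i : exists B : set M, [/\ BM B, B (val x i) & B `<=` P i `&` D i].
  have [B [BB Bx] BPD] := BM_basis.2 (val x i) _ (filterI (Px i) (Dx i)).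
  by exists B.
have [B BPD] := choice BP.
exists (config_product B).
  split; last by rewrite -xc; exists x => // i; have [] := BPD i.
  exists B; split => // [i|]; first by have [] := BPD i.
  have BD i : B i `<=` D i by have [_ _] := BPD i; rewrite subsetI => -[].
  apply/trivIsetP => i j _ _ ij; apply: subsetI_eq0 (BD i) (BD j) _.
  by move/trivIsetP : D_disj; exact.
apply: subset_trans CA => _ [y By <-]; apply: C'C; apply: PQ => i.
by have [_ _ /(_ _ (By i))[]] := BPD i.
Qed.

End config_basis.

Theorem theorem6p8 (R : realType) (K : topologicalFieldType) (n : nat)
    (M : smoothManifold R n) (k : nat) (BM : set (set M)) :
  (1 <= k)%N ->
  basis BM ->
  (forall B : set M, BM B -> diffeomorphic_to_ball B) ->
  equivalent_categories
    (vgvb_category (config_basis k BM) K)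
    (very_good_contravariant (config_basis k BM) K).
Proof.
move=> _ BM_basis _; apply: vgvb_equivalent_very_good_contravariant.
exact: config_basis_basis (@mhausdorff R n M) BM_basis.
Qed.
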